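(* Let $p\in(1,\infty)$ and $X\in\mathfrak A_p$. Let $\theta\in[0,\underline Q_\mu(1))$ and let $S\subset X$ be a closed set with $\mathcal H_\theta(S)\in(0,+\infty)$. Then $\mathfrak M^{str}_\theta(S)=\mathfrak M_\theta(S)$.
   Context: A metric measure space is a triple $X=(X,d,\mu)$ with $(X,d)$ a complete separable metric space and $\mu$ a Borel regular measure with $0<\mu(B)<\infty$ for every ball $B$ and $\operatorname{supp}\mu=X$. All balls are closed: $B_r(x)=\{y:d(x,y)\le r\}$; $r(B)$ is the radius. A measure on $X$ means a nonzero Borel regular locally finite (outer) measure. $\mu$ is uniformly locally doubling if for every $R>0$, $\sup_{r\in(0,R]}\sup_x\mu(B_{2r}(x))/\mu(B_r(x))<\infty$. $\operatorname{lip}f(x)=\limsup_{y\to x}|f(y)-f(x)|/d(x,y)$ at accumulation points, $0$ otherwise; $\mathcal E_{\mathfrak m}(f,G)=\inf_{c}\frac1{\mathfrak m(G)}\int_G|f-c|d\mathfrak m$. $X\in\mathfrak A_q$ if $\mu$ is uniformly locally doubling and for every $R>0$ there are $C>0,\lambda\ge1$ with $\mathcal E_\mu(f,B_r(x))\le Cr(\frac1{\mu(B_{\lambda r}(x))}\int_{B_{\lambda r}(x)}(\operatorname{lip}f)^qd\mu)^{1/q}$ for all Lipschitz $f$, $x$, $r\in(0,R]$. $\mu$ has relative lower volume decay of order $Q>0$ up to scale $R$ if there is $C(Q,R)>0$ with $(r(B')/r(B))^Q\le C(Q,R)\mu(B')/\mu(B)$ for all closed balls $B'\subset B$ with $r(B)<R$;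 $\operatorname{Q}_\mu(R)$ is the set of such $Q$ and $\underline Q_\mu(R)=\inf\operatorname{Q}_\mu(R)$. For $\theta\ge0$, $\mathcal H_{\theta,\delta}(E)=\inf\{\sum_i\mu(B_{r_i}(x_i))/r_i^\theta:E\subset\bigcup_iB_{r_i}(x_i),\ r_i<\delta\}$ and $\mathcal H_\theta(E)=\lim_{\delta\to0}\mathcal H_{\theta,\delta}(E)$. $\{\mathfrak m_k\}_{k=0}^\infty\in\mathfrak M_\theta(S)$ (with parameter $\epsilon\in(0,1)$) means: (M1) $\operatorname{supp}\mathfrak m_k=S$ for all $k$; (M2) there is $C_1>0$ with $\mathfrak m_k(B_r(x))\le C_1\mu(B_r(x))/r^\theta$ for all $k$, $x\in X$, $r\in(0,\epsilon^k]$; (M3) there is $C_2>0$ with $\mathfrak m_k(B_r(x))\ge C_2\mu(B_r(x))/r^\theta$ for all $k$, $x\in S$, $r\in[\epsilon^k,1]$; (M4) $\mathfrak m_k=w_k\mathfrak m_0$ with $w_k\in L^\infty(\mathfrak m_0)$ and $C_3>0$ such that $\epsilon^{\theta j}/C_3\le w_k(x)/w_{k+j}(x)\le C_3$ for $\mathfrak m_0$-a.e. $x\in S$, all $k,j$. $\{\mathfrak m_k\}\in\mathfrak M^{str}_\theta(S)$ if moreover (M5) for every Borel $E\subset S$, $\limsup_{k\to\infty}\mathfrak m_k(B_{\epsilon^k}(x)\cap E)/\mathfrak m_k(B_{\epsilon^k}(x))>0$ for $\mathfrak m_0$-a.e. $x\in E$. *)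

(* Defs.v *)
From HB Require Import structures.
From mathcomp Require Import all_boot all_order all_algebra.
From mathcomp Require Import all_classical all_reals all_analysis.
Set Implicit Arguments. Unset Strict Implicit. Unset Printing Implicit Defensive.
Import Order.TTheory GRing.Theory Num.Theory.
Local Open Scope classical_set_scope.
Local Open Scope ring_scope.

Definition cball {R : realType} {X : Type} (d : X -> X -> R) (x : X) (r : R) : set X :=
  [set y | d x y <= r].

Definition is_metric {R : realType} {X : Type} (d : X -> X -> R) : Prop :=
  [/\ (forall x y, 0 <= d x y), (forall x y, d x y = 0 <-> x = y),
      (forall x y, d x y = d y x) & (forall x y z, d x z <= d x y + d y z)].

Definition d_cauchy {R : realType} {X : Type} (d : X -> X -> R) (u : nat -> X) : Prop :=
  forall e, 0 < e -> exists N, forall m n, (N <= m)%N -> (N <= n)%N -> d (u m) (u n) < e.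

Definition d_cvg {R : realType} {X : Type} (d : X -> X -> R) (u : nat -> X) (x : X) : Prop :=
  forall e, 0 < e -> exists N, forall n, (N <= n)%N -> d (u n) x < e.

Definition d_complete {R : realType} {X : Type} (d : X -> X -> R) : Prop :=
  forall u, d_cauchy d u -> exists x, d_cvg d u x.

Definition d_separable {R : realType} {X : Type} (d : X -> X -> R) : Prop :=
  exists D : set X, countable D /\
    forall x e, 0 < e -> exists y, D y /\ d x y < e.

Definition d_open {R : realType} {X : Type} (d : X -> X -> R) (A : set X) : Prop :=
  forall x, A x -> exists r, 0 < r /\ [set y | d x y < r] `<=` A.

Definition d_closed {R : realType} {X : Type} (d : X -> X -> R) (A : set X) : Prop :=
  d_open d (~` A).

Definition d_borel {R : realType} {disp : measure_display} {X : measurableType disp}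
  (d : X -> X -> R) : Prop :=
  @measurable disp X = <<s d_open d >>.

Definition msupp {R : realType} {disp : measure_display} {X : measurableType disp}
  (d : X -> X -> R) (m : set X -> \bar R) : set X :=
  [set x | forall r, 0 < r -> (0 < m (cball d x r))%E].

Definition measure_on {R : realType} {disp : measure_display} {X : measurableType disp}
  (d : X -> X -> R) (m : set X -> \bar R) : Prop :=
  m setT <> 0%E /\
  forall x, exists r, 0 < r /\ (m (cball d x r) < +oo)%E.

Definition mms {R : realType} {disp : measure_display} {X : measurableType disp}
  (d : X -> X -> R) (mu : {measure set X -> \bar R}) : Prop :=
  [/\ is_metric d, d_complete d, d_separable d, d_borel d &
      ((forall x r, 0 < r -> (0 < mu (cball d x r) < +oo)%E) /\
       msupp d mu = setT)].

Definition unif_loc_doubling {R : realType} {disp : measure_display} {X : measurableType disp}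
  (d : X -> X -> R) (mu : set X -> \bar R) : Prop :=
  forall Rr, 0 < Rr -> exists C : R, forall x r, 0 < r -> r <= Rr ->
    (mu (cball d x (2 * r)) <= C%:E * mu (cball d x r))%E.

Definition accum_pt {R : realType} {X : Type} (d : X -> X -> R) (x : X) : Prop :=
  forall r, 0 < r -> exists y, 0 < d x y < r.

Definition lip {R : realType} {X : Type} (d : X -> X -> R) (f : X -> R) (x : X) : \bar R :=
  if pselect (accum_pt d x) is left _ then
    ereal_inf [set ereal_sup [set (`|f y - f x| / d x y)%:E | y in [set y | 0 < d x y < r]]
              | r in [set r : R | 0 < r]]
  else 0%E.

Definition lipschitz {R : realType} {X : Type} (d : X -> X -> R) (f : X -> R) : Prop :=
  exists L : R, forall x y, `|f x - f y| <= L * d x y.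

Definition osc {R : realType} {disp : measure_display} {X : measurableType disp}
  (m : {measure set X -> \bar R}) (f : X -> R) (G : set X) : \bar R :=
  ereal_inf [set (((fine (m G))^-1)%:E * \int[m]_(y in G) (`|f y - c|)%:E)%E
            | c in [set: R]].

Definition in_A {R : realType} {disp : measure_display} {X : measurableType disp}
  (d : X -> X -> R) (mu : {measure set X -> \bar R}) (q : R) : Prop :=
  unif_loc_doubling d mu /\
  forall Rr, 0 < Rr -> exists C lam : R, 0 < C /\ 1 <= lam /\
    forall f, lipschitz d f -> forall x r, 0 < r -> r <= Rr ->
      (osc mu f (cball d x r) <=
        (C * r)%:E *
        poweR (((fine (mu (cball d x (lam * r))))^-1)%:E *
               \int[mu]_(y in cball d x (lam * r)) poweR (lip d f y) q) q^-1)%E.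

Definition lower_decay {R : realType} {disp : measure_display} {X : measurableType disp}
  (d : X -> X -> R) (mu : set X -> \bar R) (Q Rr : R) : Prop :=
  exists C : R, 0 < C /\
    forall x r x' r', 0 < r -> 0 < r' -> r < Rr -> cball d x' r' `<=` cball d x r ->
      powR (r' / r) Q <= C * (fine (mu (cball d x' r')) / fine (mu (cball d x r))).

Definition Qset {R : realType} {disp : measure_display} {X : measurableType disp}
  (d : X -> X -> R) (mu : set X -> \bar R) (Rr : R) : set R :=
  [set Q | 0 < Q /\ lower_decay d mu Q Rr].

Definition Qlow {R : realType} {disp : measure_display} {X : measurableType disp}
  (d : X -> X -> R) (mu : set X -> \bar R) (Rr : R) : \bar R :=
  ereal_inf [set Q%:E | Q in Qset d mu Rr].

Definition Hdelta {R : realType} {disp : measure_display} {X : measurableType disp}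
  (d : X -> X -> R) (mu : set X -> \bar R) (th delta : R) (E : set X) : \bar R :=
  ereal_inf [set s | exists (I : set nat) (xs : nat -> X) (rs : nat -> R),
     [/\ E `<=` \bigcup_(i in I) cball d (xs i) (rs i),
         (forall i, I i -> 0 < rs i < delta) &
         s = (\sum_(i <oo | i \in I) (mu (cball d (xs i) (rs i)) * ((powR (rs i) th)^-1)%:E))%E]].

(* H_theta(E) = lim_{delta -> 0} H_{theta,delta}(E) = sup_{delta>0} (monotone limit) *)
Definition Htheta {R : realType} {disp : measure_display} {X : measurableType disp}
  (d : X -> X -> R) (mu : set X -> \bar R) (th : R) (E : set X) : \bar R :=
  ereal_sup [set Hdelta d mu th delta E | delta in [set delta : R | 0 < delta]].

Definition inM {R : realType} {disp : measure_display} {X : measurableType disp}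
  (d : X -> X -> R) (mu : {measure set X -> \bar R}) (th : R) (S : set X) (eps : R)
  (m : nat -> {measure set X -> \bar R}) : Prop :=
  0 < eps < 1 /\
  [/\
      (forall k, measure_on d (m k)),
      (* M1 *) (forall k, msupp d (m k) = S),
      (* M2 *) (exists C1 : R, 0 < C1 /\ forall k x r, 0 < r -> r <= eps ^+ k ->
                 (m k (cball d x r) <= mu (cball d x r) * (C1 / powR r th)%:E)%E),
      (* M3 *) (exists C2 : R, 0 < C2 /\ forall k x r, S x -> eps ^+ k <= r -> r <= 1 ->
                 (mu (cball d x r) * (C2 / powR r th)%:E <= m k (cball d x r))%E) &
      (* M4 *) (exists w : nat -> X -> R,
                 (forall k, [/\ measurable_fun setT (w k),
                     (exists M : R, {ae m 0%N, forall x, `|w k x| <= M}) &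
                     (forall A, measurable A -> m k A = (\int[m 0%N]_(x in A) (w k x)%:E)%E)]) /\
                 exists C3 : R, 0 < C3 /\ forall k j : nat,
                   {ae m 0%N, forall x, S x ->
                      powR eps (th * j%:R) / C3 <= w k x / w (k + j)%N x <= C3})].

Definition inMstr {R : realType} {disp : measure_display} {X : measurableType disp}
  (d : X -> X -> R) (mu : {measure set X -> \bar R}) (th : R) (S : set X) (eps : R)
  (m : nat -> {measure set X -> \bar R}) : Prop :=
  inM d mu th S eps m /\
  (* M5 *) forall E, measurable E -> E `<=` S ->
    {ae m 0%N, forall x, E x ->
       (0 < limn_esup (fun k => (fine (m k (cball d x (eps ^+ k) `&` E))
                                  / fine (m k (cball d x (eps ^+ k))))%:E))%E}.

(* Main.v *)
Require Import Defs.
From HB Require Import structures.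
From mathcomp Require Import all_boot all_order all_algebra.
From mathcomp Require Import all_classical all_reals all_analysis.
From mathcomp Require Import measurable_realfun ring lra.
Set Implicit Arguments. Unset Strict Implicit. Unset Printing Implicit Defensive.
Import Order.TTheory GRing.Theory Num.Theory.
Local Open Scope classical_set_scope.
Local Open Scope ring_scope.

(** Let F be the set of points of E where (M5) fails.  (M4) with k = 0 gives
    m_0 <= C_3 m_k on S, hence by (M2) every x in F satisfies, for each
    eta > 0 and all large k,
      m_0(B_{eps^k}(x) /\ E) <= C_3 C_1 eta mu(B_{eps^k}(x)) / eps^{k theta}.
    Enlarging an almost optimal cover of S for H_theta to balls of radii eps^k
    centred in F costs a constant factor by doubling, so the outer m_0-measure
    of F is at most a constant times eta (H_theta(S) + 1). *)

(** * Balls, iterated doubling and geometric scales *)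

Lemma measurable_cball (R : realType) (disp : measure_display)
  (X : measurableType disp) (d : X -> X -> R) (x : X) (r : R) :
  is_metric d -> d_borel d -> measurable (cball d x r).
Proof.
move=> [_ _ dC dT] bd; rewrite -[cball _ _ _]setCK; apply: measurableC.
rewrite bd; apply: sub_sigma_algebra => y /= /negP; rewrite -ltNge => ry.
exists (d x y - r); split; first by rewrite subr_gt0.
move=> z /= yz /=; apply/negP; rewrite -ltNge.
by have := dT x z y; rewrite (dC z y); lra.
Qed.

Lemma doubling_iter (R : realType) (disp : measure_display)
  (X : measurableType disp) (d : X -> X -> R) (mu : {measure set X -> \bar R})
  (n : nat) :
  unif_loc_doubling d mu -> exists2 D : R, 0 <= D &
    forall x r, 0 < r <= 1 ->
      (mu (cball d x (2 ^+ n * r)) <= D%:E * mu (cball d x r))%E.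
Proof.
move=> dbl; elim: n => [|n [D D0 IH]].
  by exists 1 => // x r _; rewrite expr0 mul1r mul1e.
(* The radius still to be doubled, [2 ^+ n * r], may reach [2 ^+ n], which sets the scale bound. The
   sign of [C] is not prescribed, whence [Num.max C 0]. *)
have [C HC] := dbl (2 ^+ n) (exprn_gt0 n (ltr0Sn R 1)).
exists (Num.max C 0 * D) => [|x r /andP[r0 r1]].
  by rewrite mulr_ge0 // le_max lexx orbT.
rewrite exprS -mulrA; apply: le_trans (HC x _ _ _) _.
- by rewrite mulr_gt0 // exprn_gt0.
- by rewrite ler_piMr // exprn_ge0.
rewrite EFinM -muleA; apply: le_trans
  (_ : ((Num.max C 0)%:E * mu (cball d x (2 ^+ n * r)) <= _)%E).
  by rewrite lee_wpmul2r // lee_fin le_max lexx.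
by rewrite lee_wpmul2l ?lee_fin ?le_max ?lexx ?orbT // IH // r0.
Qed.

(** Here [k.+1] is the least exponent whose power of [e] falls below [t]. It is nonzero since
    [t <= e ^+ j <= 1], and [k < j] would give [e ^+ j <= e ^+ k.+1 < t]. *)
Lemma expr_bracket (R : realType) (e t : R) (j : nat) :
  0 < e < 1 -> 0 < t <= e ^+ j ->
  exists2 k, (j <= k)%N & e ^+ k.+1 < t <= e ^+ k.
Proof.
move=> /andP[e0 e1] /andP[t0 tj].
have [n en] : exists n, e ^+ n < t.
  have e1' : `|e| < 1 by rewrite gtr0_norm.
  have /cvgrPdist_lt /(_ t t0) [n _ /(_ n (leqnn n))] := cvg_expr e1'.
  by rewrite /= sub0r normrN gtr0_norm ?exprn_gt0 //; exists n.
have ex : exists n, e ^+ n < t by exists n.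
case: (ex_minnP ex) => -[|k] ek min.
  by move: (lt_le_trans ek tj); rewrite ltNge exprn_ile1 // ltW.
have tk : t <= e ^+ k.
  by rewrite leNgt; apply/negP => /min; rewrite ltnn.
exists k; last by rewrite ek.
rewrite leqNgt; apply/negP => kj.
have := lt_le_trans ek tj; rewrite ltNge.
by rewrite ler_wiXn2l ?ltW.
Qed.

(** * Measurable covers, null sets and comparison of densities *)

(* The F_j need not be measurable; continuity from below is applied to the
   measurable sets V_j, the intersections of all covers from index j on. *)
Lemma cover_nondecreasing (R : realType) (disp : measure_display)
  (X : measurableType disp) (nu : {measure set X -> \bar R})
  (F : nat -> set X) (t : \bar R) :
  {homo F : i j / (i <= j)%N >-> i `<=` j} ->
  (forall j, exists U, [/\ measurable U, F j `<=` U & (nu U <= t)%E]) ->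
  exists U, [/\ measurable U, \bigcup_j F j `<=` U & (nu U <= t)%E].
Proof.
move=> Fmono /choice[U HU].
pose V j := \bigcap_(i in [set i | (j <= i)%N]) U i.
have mV j : measurable (V j).
  by apply: bigcap_measurable => // [|i _]; [exists j => /=|have [] := HU i].
have mUV : measurable (\bigcup_j V j) by apply: bigcup_measurable.
exists (\bigcup_j V j); split => //.
  move=> x [j _ Fx]; exists j => // i /= ji.
  by have [_ sub _] := HU i; apply/sub/(Fmono _ _ ji).
apply: (cvge_le _ (nondecreasing_cvg_mu (mu := nu) mV mUV _)).
  exists 0%N => // j _ /=; have [mU _ Ut] := HU j.
  apply: le_trans Ut; apply: le_measure; rewrite ?inE //.
  by move=> x; apply => /=.
move=> i j ij; apply/subsetPset => x Vx k /= jk.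
by apply: Vx => /=; exact: leq_trans jk.
Qed.

Lemma negligible_small_covers (R : realType) (disp : measure_display)
  (X : measurableType disp) (nu : {measure set X -> \bar R}) (F : set X) :
  (forall e : R, 0 < e ->
    exists U, [/\ measurable U, F `<=` U & (nu U <= e%:E)%E]) ->
  nu.-negligible F.
Proof.
move=> H; have /choice[U HU] : forall n : nat, exists U,
    [/\ measurable U, F `<=` U & (nu U <= (n.+1%:R^-1)%:E)%E].
  by move=> n; apply: H; rewrite invr_gt0.
have mU : measurable (\bigcap_n U n).
  by apply: bigcap_measurable => // n _; have [] := HU n.
exists (\bigcap_n U n); split => //; last first.
  by move=> x Fx n _; have [_ + _] := HU n; apply.
apply/eqP; rewrite eq_le measure_ge0 andbT; apply/lee_addgt0Pr => e e0.
have [n _ /(_ n (leqnn n)) ne] := near_infty_natSinv_lt (PosNum e0).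
have [mUn _ Un] := HU n; rewrite add0e.
apply: le_trans (le_trans Un _); last by rewrite lee_fin ltW.
by apply: le_measure; rewrite ?inE // => x; apply.
Qed.

(** Off a null set [w0 <= C * wk], and this integrates. The exceptional set is null for [m0], so
    discarding it preserves [m0 A]; it can only decrease [mk A], which is the harmless direction. *)
Lemma weight_lower_bound (R : realType) (disp : measure_display)
  (X : measurableType disp) (m0 mk : {measure set X -> \bar R})
  (S : set X) (w0 wk : X -> R) (a C : R) :
  measurable_fun setT w0 -> measurable_fun setT wk -> 0 < a -> 0 < C ->
  (forall A, measurable A -> m0 A = (\int[m0]_(x in A) (w0 x)%:E)%E) ->
  (forall A, measurable A -> mk A = (\int[m0]_(x in A) (wk x)%:E)%E) ->
  {ae m0, forall x, S x -> a <= w0 x / wk x <= C} ->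
  forall A, measurable A -> A `<=` S -> (m0 A <= C%:E * mk A)%E.
Proof.
move=> mw0 mwk a0 C0 m0E mkE [N [mN N0 subN]] A mA AS.
(* The sign of [w0] is deduced rather than assumed: [m0 P] is the integral of the negative function
   [w0] over [P], so it is both nonnegative and nonpositive. *)
pose P := [set x | w0 x < 0].
have mP : measurable P.
  rewrite (_ : P = setT `&` w0 @^-1` `]-oo, 0[).
    by apply: mw0 => //; exact: measurable_itv.
  by apply/seteqP; split=> x; rewrite /= in_itv /=; [|case].
have P0 : m0 P = 0%E.
  apply/eqP; rewrite eq_le measure_ge0 andbT m0E //.
  rewrite (_ : (fun x => _) = (fun x => - (- w0 x)%:E))%E; last first.
    by apply/funext => x; rewrite EFinN oppeK.
  have w0N x : P x -> (0 <= (- w0 x)%:E)%E.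
    by move=> h; rewrite lee_fin oppr_ge0 ltW.
  by rewrite integral_ge0N // oppe_le0; exact: integral_ge0.
pose A' := A `\` (N `|` P).
have mNP : measurable (N `|` P) by apply: measurableU.
have mA' : measurable A' by apply: measurableD.
have NP0 : m0 (N `|` P) = 0%E by rewrite measureU0.
have pos x : A' x -> 0 <= w0 x <= C * wk x.
  move=> [Ax /not_orP[Nx /negP]]; rewrite -leNgt => w0x.
  have /andP[l u] : a <= w0 x / wk x <= C.
    by apply: contrapT => h; apply: Nx; apply: subN => /= /(_ (AS _ Ax)).
  rewrite w0x /=; have q0 := lt_le_trans a0 l.
  (* With the convention [0^-1 = 0], a zero of [wk] makes the quotient zero, and a negative value
     makes it nonpositive; both contradict [0 < a]. *)
  have wk0 : 0 < wk x.
    rewrite lt_neqAle; apply/andP; split.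
      by apply: contraTneq q0 => <-; rewrite invr0 mulr0 ltxx.
    rewrite leNgt; apply: contraTN q0 => wkx.
    by rewrite -leNgt mulr_ge0_le0 // invr_le0 ltW.
  by rewrite -ler_pdivrMr.
have -> : m0 A = m0 A'.
  have mANP : measurable (A `&` (N `|` P)) by apply: measurableI.
  rewrite (measureDI _ mA mNP) [X in (_ + X)%E](_ : _ = 0%E) ?adde0 //.
  by apply: subset_measure0 NP0 => // x [].
apply: le_trans (_ : (C%:E * mk A' <= _)%E); last first.
  by rewrite lee_pmul2l ?lte_fin // le_measure ?inE // /A'; exact: subDsetl.
have mf (f : X -> R) : measurable_fun setT f ->
    measurable_fun A' (EFin \o f).
  by move=> h; apply/measurable_EFinP; apply: measurable_funS h.
have wk_ge0 x : A' x -> 0 <= wk x.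
  by move=> /pos /andP[w0x]; rewrite -(pmulr_rge0 _ C0); apply: le_trans.
rewrite m0E // mkE // -ge0_integralZl //; last 2 first.
- exact: mf.
- by rewrite lee_fin ltW.
apply: ge0_le_integral => //.
- by move=> x /pos /andP[]; rewrite lee_fin.
- exact: mf.
- by apply: (mf (fun x => C * wk x)); apply: measurable_funM.
- by move=> x /pos /andP[]; rewrite -EFinM lee_fin.
Qed.

(** * Recentring covers at scales [eps ^+ k] *)

Lemma gauge_enlarge (R : realType) (disp : measure_display)
  (X : measurableType disp) (d : X -> X -> R) (mu : {measure set X -> \bar R})
  (th eps : R) :
  is_metric d -> d_borel d -> unif_loc_doubling d mu -> 0 <= th -> 0 < eps ->
  exists2 D : R, 0 <= D & forall x y r k,
    d x y <= r -> 0 < r <= 1 -> eps ^+ k.+1 < 2 * r <= eps ^+ k ->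
    (mu (cball d y (eps ^+ k)) * ((powR (eps ^+ k) th)^-1)%:E
     <= D%:E * (mu (cball d x r) * ((powR r th)^-1)%:E))%E.
Proof.
move=> md bd dbl th0 e0.
(* From [eps ^+ k.+1 < 2 * r] follows [eps ^+ k <= 2 / eps * r], so the ball of radius [eps ^+ k]
   about [y] lies in the ball of radius [(2 / eps + 1) * r] about [x]. Thus [n] doublings suffice,
   with [n] depending on [eps] alone. *)
have [n Hn] : exists n : nat, 2 / eps + 1 <= 2 ^+ n.
  have q0 : 0 <= 2 / eps + 1 by rewrite addr_ge0 // divr_ge0 // ltW.
  exists (Num.bound (2 / eps + 1)); rewrite (le_trans (ltW (archi_boundP q0))) //.
  by rewrite -natrX ler_nat ltnW // ltn_expl.
have [D D0 HD] := doubling_iter n dbl.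
exists D => // x y r k xy /andP[r0 r1] /andP[kr rk].
have ek0 : 0 < eps ^+ k by rewrite exprn_gt0.
rewrite muleA; apply: lee_pmul => //.
- by rewrite lee_fin invr_ge0 powR_ge0.
- apply: le_trans (HD x r _); last by rewrite r0.
  apply: le_measure; rewrite ?inE; [exact: measurable_cball..|].
  have [_ _ _ dT] := md.
  move=> z /= yz; rewrite /cball /=.
  have ekr : eps ^+ k <= 2 / eps * r.
    by rewrite mulrAC ler_pdivlMr // -exprSr ltW.
  apply: le_trans (dT x y z) _.
  apply: le_trans (ler_wpM2r (ltW r0) Hn).
  by rewrite mulrDl mul1r addrC lerD // (le_trans yz).
- rewrite lee_fin lef_pV2 ?posrE ?powR_gt0 //.
  apply: ge0_ler_powR; rewrite // ?nnegrE; try exact: ltW.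
  by apply: le_trans rk; lra.
Qed.

(** The density bound is known only at points of [F] and radii [eps ^+ k], so cover balls meeting
    [F] are recentred there. The constant [D] is fixed before [nu], [eta] and [j], which lets [eta]
    be chosen afterwards in terms of [D]. *)
Lemma small_density_cover (R : realType) (disp : measure_display)
  (X : measurableType disp) (d : X -> X -> R) (mu : {measure set X -> \bar R})
  (th eps : R) :
  is_metric d -> d_borel d -> unif_loc_doubling d mu -> 0 <= th ->
  0 < eps < 1 ->
  exists2 D : R, 0 <= D &
  forall (nu : {measure set X -> \bar R}) (S E F : set X) (eta T : R) (j : nat),
    measurable E -> F `<=` E -> F `<=` S -> (Htheta d mu th S < T%:E)%E ->
    0 <= eta ->
    (forall x k, F x -> (j <= k)%N ->
      (nu (cball d x (eps ^+ k) `&` E) <=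
       eta%:E * (mu (cball d x (eps ^+ k)) * ((powR (eps ^+ k) th)^-1)%:E))%E) ->
    exists U, [/\ measurable U, F `<=` U & (nu U <= (eta * D * T)%:E)%E].
Proof.
move=> md bd dbl th0 e01; have /andP[e0 e1] := e01.
have [D D0 HD] := gauge_enlarge md bd dbl th0 e0.
exists D => // nu S E F eta T j mE FE FS HT eta0 dens.
(* Radii below [delta] satisfy [2 * rs i <= eps ^+ j], so the bracketing exponent is at least [j],
   where the density bound applies. *)
pose delta := eps ^+ j / 2.
have ej1 : eps ^+ j <= 1 by rewrite exprn_ile1 // ltW.
have delta0 : 0 < delta by rewrite divr_gt0 // exprn_gt0.
have /ereal_inf_lt[_ [I [xs [rs [cov rsd ->]]]] sT] :
    (Hdelta d mu th delta S < T%:E)%E.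
  by apply: le_lt_trans HT; apply: ereal_sup_ubound; exists delta.
pose h i := (mu (cball d (xs i) (rs i)) * ((powR (rs i) th)^-1)%:E)%E.
have h0 i : (0 <= h i)%E by rewrite mule_ge0 // lee_fin invr_ge0 powR_ge0.
(* Indices outside [I], or whose ball misses [F], receive the empty set. Otherwise [V] is the part
   in [E] of a ball centred at a point of [F]; its radius is at least [2 * rs i], so it contains the
   trace of the old ball on [F]. *)
have /choice[V HV] : forall i, exists V, [/\ measurable V,
    (I i -> F `&` cball d (xs i) (rs i) `<=` V) &
    (nu V <= if i \in I then (eta * D)%:E * h i else 0)%E].
  move=> i; case: ifPn => [|/negP]; rewrite inE => Ii; last first.
    by exists set0; split => //; rewrite measure0.
  have [[y [Fy xy]]|noF] := pselect (F `&` cball d (xs i) (rs i) !=set0);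
    last first.
    exists set0; split => //.
      by move=> _ y Fy; apply: noF; exists y.
    by rewrite measure0 mule_ge0 // lee_fin mulr_ge0.
  have /andP[ri0 rid] := rsd _ Ii.
  have rij : 2 * rs i <= eps ^+ j by rewrite mulrC -ler_pdivlMr // ltW.
  have [k jk ek] : exists2 k, (j <= k)%N & eps ^+ k.+1 < 2 * rs i <= eps ^+ k.
    by apply: expr_bracket => //; rewrite rij andbT mulr_gt0.
  have [_ _ dC dT] := md; have /andP[_ rk] := ek.
  exists (cball d y (eps ^+ k) `&` E); split.
  - by apply: measurableI => //; exact: measurable_cball.
  - move=> _ z [Fz xz]; split; last exact: FE.
    rewrite /cball /=; apply: le_trans rk.
    apply: le_trans (dT y (xs i) z) _; rewrite (dC y).
    by rewrite mulrDl !mul1r lerD.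
  apply: le_trans (dens _ _ Fy jk) _.
  rewrite EFinM -muleA lee_wpmul2l ?lee_fin //.
  apply: HD => //; rewrite ri0 /=; lra.
have mUV : measurable (\bigcup_i V i).
  by apply: bigcup_measurable => i _; have [] := HV i.
exists (\bigcup_i V i); split => //.
  move=> x Fx; have [i Ii xi] := cov _ (FS _ Fx).
  by exists i => //; have [_ /(_ Ii) + _] := HV i; apply.
apply: le_trans (_ : \sum_(i <oo) nu (V i) <= _)%E.
  by apply: measure_sigma_subadditive => // i; have [] := HV i.
apply: le_trans (_ : \sum_(i <oo) (if i \in I then (eta * D)%:E * h i else 0) <= _)%E.
  by apply: lee_nneseries => // i _; have [] := HV i.
rewrite -(@eseries_mkcond _ (fun i => i \in I)) nneseriesZl //.
rewrite (EFinM (eta * D)) lee_wpmul2l ?(ltW sT) //.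
by rewrite lee_fin mulr_ge0.
Qed.

(** * Points where (M5) fails are negligible *)

Lemma limn_esup_le_near (R : realType) (u : (\bar R)^nat) (e : R) :
  0 < e -> ~ (0 < limn_esup u)%E ->
  exists j, forall k, (j <= k)%N -> (u k <= e%:E)%E.
Proof.
move=> e0 /negP; rewrite -leNgt => u0.
have /ereal_inf_lt[_ [V [j _ jV] <-] Ve] : (limn_esup u < e%:E)%E.
  by apply: le_lt_trans u0 _; rewrite lte_fin.
exists j => k jk; apply: le_trans (ltW Ve); apply: ereal_sup_ubound.
by exists k => //; exact: jV.
Qed.

Theorem mainTheorem9 (R : realType) (disp : measure_display) (X : measurableType disp)
  (d : X -> X -> R) (mu : {measure set X -> \bar R}) (p th : R) (S : set X) :
  mms d mu -> 1 < p -> in_A d mu p ->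
  0 <= th -> (th%:E < Qlow d mu 1)%E ->
  d_closed d S -> (0 < Htheta d mu th S < +oo)%E ->
  forall (eps : R) (m : nat -> {measure set X -> \bar R}),
    inMstr d mu th S eps m <-> inM d mu th S eps m.
Proof.
move=> [md _ _ bd [mufin _]] _ [dbl _] th0 _ _ /andP[H0 Hoo] eps m.
split=> [[]//|hM]; split=> // E mE ES.
have [e01 [_ M1 [C1 [C10 M2]] _ [w [Hw [C3 [C30 M4]]]]]] := hM.
have /andP[e0 e1] := e01.
(* The lower bound in (M4) depends on [k] but enters only through its positivity; the resulting
   constant [C3] is uniform in [k]. *)
have m0_le k A : measurable A -> A `<=` S -> (m 0%N A <= C3%:E * m k A)%E.
  have [[mw0 _ m0E] [mwk _ mkE]] := (Hw 0%N, Hw k).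
  apply: (weight_lower_bound mw0 mwk _ C30 m0E mkE (M4 0%N k)).
  by rewrite divr_gt0 // powR_gt0.
have [D D0 cover] := small_density_cover md bd dbl th0 e01.
have [T T0 HT] : exists2 T : R, 0 < T & (Htheta d mu th S < T%:E)%E.
  have Hfin : Htheta d mu th S \is a fin_num by rewrite ge0_fin_numE // ltW.
  exists (fine (Htheta d mu th S) + 1).
    by rewrite ltr_wpDl // fine_ge0 // ltW.
  by rewrite -[ltLHS]fineK // lte_fin ltrDl.
apply: negligible_small_covers => e epos.
pose K := C3 * C1 * D * T.
have K0 : 0 <= K by rewrite /K !mulr_ge0 // ltW.
(* The cover produced below has measure at most [eta * K]. Dividing by [K + 1] allows for
   [K = 0]. *)
have [eta eta0 etaK] : exists2 eta : R, 0 < eta & eta * K <= e.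
  exists (e / (K + 1)); first by rewrite divr_gt0 // ltr_wpDl.
  by rewrite mulrAC ler_pdivrMr ?ltr_wpDl // ler_pM2l // lerDl.
pose ratio k x := fine (m k (cball d x (eps ^+ k) `&` E)) /
  fine (m k (cball d x (eps ^+ k))).
(* The scale from which the ratio stays below [eta] varies with the point; [F j] collects the points
   for which [j] works. Each [F j] has a cover of measure at most [e], uniformly in [j], so the
   increasing union has one too. *)
pose F j := [set x | E x /\ forall k, (j <= k)%N -> ratio k x <= eta].
have [||U [mU FU Ue]] := @cover_nondecreasing _ _ _ (m 0%N) F e%:E.
- by move=> i j ij x [Ex Hx]; split=> // k jk; apply: Hx; exact: leq_trans jk.
- move=> j.
  have FE : F j `<=` E by move=> x [].
  have [|x k [Ex Hx] jk|U [mU FU Ue]] := cover (m 0%N) S E (F j)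
    (C3 * (eta * C1)) T j mE FE (subset_trans FE ES) HT.
  + by rewrite ltW // !mulr_gt0.
  + have ek0 : 0 < eps ^+ k by rewrite exprn_gt0.
    have mB : measurable (cball d x (eps ^+ k)) by exact: measurable_cball.
    have mBE : measurable (cball d x (eps ^+ k) `&` E) by exact: measurableI.
    (* Clearing the denominator of [ratio] needs a ball of positive finite measure: positivity comes
       from (M1), finiteness from (M2) at its largest admissible radius [eps ^+ k]. *)
    have Bpos : (0 < m k (cball d x (eps ^+ k)))%E.
      have xS : msupp d (m k) x by rewrite M1; exact: ES.
      exact: xS.
    have Bfin : m k (cball d x (eps ^+ k)) \is a fin_num.
      rewrite ge0_fin_numE //; apply: le_lt_trans (M2 k x _ ek0 (lexx _)) _.
      have /andP[_ muoo] := mufin x _ ek0.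
      by rewrite muleC lte_mul_pinfty // lee_fin divr_ge0 ?powR_ge0 // ltW.
    have BEle : (m k (cball d x (eps ^+ k) `&` E) <= m k (cball d x (eps ^+ k)))%E.
      by apply: le_measure; rewrite ?inE.
    have BEfin : m k (cball d x (eps ^+ k) `&` E) \is a fin_num.
      by rewrite ge0_fin_numE // (le_lt_trans BEle) // -ge0_fin_numE.
    have small : (m k (cball d x (eps ^+ k) `&` E) <=
        eta%:E * m k (cball d x (eps ^+ k)))%E.
      rewrite -(fineK BEfin) -(fineK Bfin) -EFinM lee_fin.
      rewrite -ler_pdivrMr; first exact: Hx.
      by rewrite fine_gt0 // Bpos -ge0_fin_numE.
    (* Three factors accumulate: [C3] passes from [m 0] to [m k], [eta] from the part in [E] to the
       whole ball, and [C1] from [m k] to the gauge of [mu]. *)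
    apply: le_trans (m0_le k _ mBE (fun z => ES z \o snd)) _.
    rewrite EFinM -muleA lee_pmul2l ?lte_fin //.
    apply: le_trans small _; rewrite EFinM -muleA lee_pmul2l ?lte_fin //.
    apply: le_trans (M2 k x _ ek0 (lexx _)) _.
    by rewrite EFinM muleCA.
  exists U; split=> //; apply: le_trans Ue _; rewrite lee_fin.
  by rewrite (_ : _ * T = eta * K) // /K; ring.
exists U; split=> // x /= /not_implyP[Ex nx]; apply: FU.
have [j Hj] := limn_esup_le_near eta0 nx.
by exists j => //; split=> // k /Hj; rewrite lee_fin.
Qed.
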